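(* Let $X$ be a finitely ramified fractal. Then: (1) Any two undistorted metrics on $X$ are quasisymmetrically equivalent. (2) If a metric $d$ on $X$ is undistorted, then so is any metric on $X$ which is quasisymmetrically equivalent to $d$.
   Context: A finitely ramified cell structure on a compact, connected, metrizable space $X$ consists of a locally finite rooted tree of subsets of $X$, called cells, such that: (1) every cell is compact, connected, and has nonempty interior; (2) the root is the whole space $X$, and each cell is the union of its children; (3) the intersection of any two distinct cells at the same level is a finite set; (4) for every infinite descending path $X=E_0\supseteq E_1\supseteq\cdots$ in the tree, $\bigcap_n E_n$ is a single point. Cells at level $n$ are called $n$-cells (the root being at level $0$). The same subset may occur at several levels; formally a cell is a pair $(E,n)$. A finitely ramified fractal is a metrizable space with a finitely ramified cell structure. Metrics on $X$ are understood to induce the topology of $X$. A metric $d$ on $X$ is undistorted if: (Exponential Decay) there are constants $0<r\le R<1$ and $C\ge1$ such that $\frac{r^{n-m}}{C}\le\frac{\operatorname{diam}(E')}{\operatorname{diam}(E)}\le CR^{n-m}$ for every $m$-cell $E$ and $n$-cell $E'$ with $n\ge m$ and $E\cap E'\neq\emptyset$; and (Cell Separation) there is $\delta>0$ such that $d(E_1,E_2)\ge\delta\operatorname{diam}(E_1)$ for every pair $E_1,E_2$ of disjoint $n$-cells (same $n$), where $d(E_1,E_2)=\inf\{d(x,y):x\in E_1,y\in E_2\}$. A homeomorphism $h\colon (X,d_X)\to (Y,d_Y)$ between metric spaces is a quasisymmetry if there is a homeomorphism $\eta\colon[0,\infty)\to[0,\infty)$ with $\frac{d_Y(h(a),h(b))}{d_Y(h(a),h(c))}\le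 \eta\left(\frac{d_X(a,b)}{d_X(a,c)}\right)$ for every triple $a,b,c$ of distinct points of $X$. Two metrics $d,d'$ on $X$ are quasisymmetrically equivalent if the identity map $(X,d)\to(X,d')$ is a quasisymmetry. *)

(* Defs.v *)
From HB Require Import structures.
From mathcomp Require Import all_boot all_order all_algebra.
From mathcomp Require Import all_classical all_reals all_analysis.

Set Implicit Arguments.
Unset Strict Implicit.
Unset Printing Implicit Defensive.

Import Order.TTheory GRing.Theory Num.Theory.
Import numFieldNormedType.Exports.

Local Open Scope classical_set_scope.
Local Open Scope ring_scope.

(* A metric inducing the given topology of X.  The library's [metricType]
   attaches a single metric to a type; here several metrics on one space are
   compared, so they are first-class objects. *)
Record metric (R : realType) (X : topologicalType) := Metric {
  mdst :> X -> X -> R;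
  mdst_ge0 : forall x y, 0 <= mdst x y;
  mdst_eq0 : forall x y, mdst x y = 0 <-> x = y;
  mdst_sym : forall x y, mdst x y = mdst y x;
  mdst_triangle : forall x y z, mdst x z <= mdst x y + mdst y z;
  mdst_nbhs : forall x (A : set X),
    nbhs x A <-> exists2 e, 0 < e & [set y | mdst x y < e] `<=` A
}.

Definition metrizable (R : realType) (X : topologicalType) : Prop :=
  exists _ : metric R X, True.

(* [cells n] is the set of n-cells, so that a vertex of the tree is a pair
   (E, n) with [cells n E].  If E is an (n+1)-cell, [parent n E] is the n-cell
   above it; [parent n] carries no information on sets that are not
   (n+1)-cells. *)
Record cell_tree (X : topologicalType) := CellTree {
  cells : nat -> set (set X);
  parent : nat -> set X -> set X;
  cells_root : cells 0%N = [set [set: X]];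
  parent_cells : forall n E, cells n.+1 E -> cells n (parent n E)
}.

Definition children (X : topologicalType) (T : cell_tree X) (n : nat)
    (E : set X) : set (set X) :=
  [set E' | cells T n.+1 E' /\ parent T n E' = E].

Definition descending_path (X : topologicalType) (T : cell_tree X)
    (E : nat -> set X) : Prop :=
  E 0%N = [set: X] /\ forall n, children T n (E n) (E n.+1).

Record cell_structure (X : topologicalType) := CellStructure {
  cell_structure_tree :> cell_tree X;
  locally_finite : forall n E, cells cell_structure_tree n E ->
    finite_set (children cell_structure_tree n E);
  cells_compact : forall n E, cells cell_structure_tree n E -> compact E;
  cells_connected : forall n E, cells cell_structure_tree n E -> connected E;
  cells_interior : forall n E, cells cell_structure_tree n E ->
    interior E !=set0;
  cells_children : forall n E, cells cell_structure_tree n E ->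
    E = \bigcup_(E' in children cell_structure_tree n E) E';
  cells_meet : forall n E E', cells cell_structure_tree n E ->
    cells cell_structure_tree n E' -> E <> E' -> finite_set (E `&` E');
  path_point : forall E : nat -> set X,
    descending_path cell_structure_tree E ->
    exists x : X, \bigcap_n E n = [set x]
}.

Definition diam (R : realType) (X : topologicalType) (d : metric R X)
    (E : set X) : R :=
  sup [set d x y | x in E & y in E].

Definition setdist (R : realType) (X : topologicalType) (d : metric R X)
    (E1 E2 : set X) : R :=
  inf [set d x y | x in E1 & y in E2].

(* Cells are nonempty and compact, so the suprema and infima above are those
   of nonempty bounded sets.  A cell has diameter 0 only if X is a single
   point; as x / 0 = 0, the lower bound then fails, i.e. the metric on a
   one-point space, where the ratios are undefined, is not undistorted. *)
Definition exponential_decay (R : realType) (X : topologicalType)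
    (T : cell_structure X) (d : metric R X) : Prop :=
  exists r1 r2 C : R, [/\ 0 < r1, r1 <= r2, r2 < 1, 1 <= C &
    forall m n E E', (m <= n)%N -> cells T m E -> cells T n E' ->
      E `&` E' !=set0 ->
      r1 ^+ (n - m) / C <= diam d E' / diam d E /\
      diam d E' / diam d E <= C * r2 ^+ (n - m)].

Definition cell_separation (R : realType) (X : topologicalType)
    (T : cell_structure X) (d : metric R X) : Prop :=
  exists2 delta : R, 0 < delta &
    forall n E1 E2, cells T n E1 -> cells T n E2 -> E1 `&` E2 = set0 ->
      delta * diam d E1 <= setdist d E1 E2.

Definition undistorted (R : realType) (X : topologicalType)
    (T : cell_structure X) (d : metric R X) : Prop :=
  exponential_decay T d /\ cell_separation T d.

(* f restricts to a homeomorphism from the subspace A onto the subspace B. *)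
Definition homeomorphism (U V : topologicalType) (A : set U) (B : set V)
    (f : U -> V) : Prop :=
  (forall x, A x -> B (f x)) /\
  exists g : V -> U, [/\ forall y, B y -> A (g y),
    forall x, A x -> g (f x) = x, forall y, B y -> f (g y) = y,
    {within A, continuous f} & {within B, continuous g}].

Definition quasisymmetry (R : realType) (X Y : topologicalType)
    (dX : metric R X) (dY : metric R Y) (h : X -> Y) : Prop :=
  homeomorphism [set: X] [set: Y] h /\
  exists2 eta : R -> R,
    homeomorphism [set t : R | 0 <= t] [set t : R | 0 <= t] eta &
    forall a b c : X, a <> b -> a <> c -> b <> c ->
      dY (h a) (h b) / dY (h a) (h c) <= eta (dX a b / dX a c).

Definition quasisymmetrically_equivalent (R : realType) (X : topologicalType)
    (d d' : metric R X) : Prop :=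
  quasisymmetry d d' (fun x : X => x).

(* Main.v *)
(* If a <> b, there is a level n at which some n-cells around a and b meet while
   no (n+1)-cells around them do.  Exponential decay bounds d(a, b) above by a
   multiple of the diameter of any n-cell at a, and cell separation at level
   n+1 bounds it below by such a multiple.  As n does not depend on the metric,
   ratios of distances in two undistorted metrics are compared through powers of
   the decay rates, which gives eta of the form t |-> L max ((K t)^(1/N)) ((K t)^N).

   Conversely, eta controls d'-diameters of intersecting sets by the ratio of
   their d-diameters.  Hence passing to a child shrinks d'-diameters by at most
   a bounded factor and, since eta(t) -> 0 as t -> 0, descending a fixed number
   N of levels halves them; iterating along ancestors gives exponential decay.
   Cell separation for d' is one application of the quasisymmetry inequality. *)
Require Import Defs.
From mathcomp Require Import all_boot all_order all_algebra.
From mathcomp Require Import all_classical all_reals all_analysis.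
From mathcomp Require Import ring lra zify.

Set Implicit Arguments.
Unset Strict Implicit.
Unset Printing Implicit Defensive.

Import Order.TTheory GRing.Theory Num.Theory.
Import numFieldNormedType.Exports.

Local Open Scope classical_set_scope.
Local Open Scope ring_scope.

(** * Diameters and distances of sets in a compact metric space *)

Lemma mdstxx (R : realType) (X : topologicalType) (d : metric R X) x :
  d x x = 0.
Proof. exact/mdst_eq0. Qed.

Lemma mdst_gt0 (R : realType) (X : topologicalType) (d : metric R X) x y :
  x <> y -> 0 < d x y.
Proof.
move=> xy; rewrite lt_neqAle mdst_ge0 andbT eq_sym.
by apply/eqP => /mdst_eq0.
Qed.

Lemma mdst_continuous (R : realType) (X : topologicalType) (d : metric R X) x :
  continuous (d x : X -> R).
Proof.
move=> y; apply/cvgrPdist_lt => e e0; apply/(mdst_nbhs d).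
exists e => // z /= yz; rewrite ltr_norml.
have := mdst_triangle d x y z; have := mdst_triangle d x z y.
rewrite (mdst_sym d z y); lra.
Qed.

Lemma mdst_bounded (R : realType) (X : topologicalType) (d : metric R X) :
  compact [set: X] -> exists M, forall x y, d x y <= M.
Proof.
move=> cX; have [[x0 _]|X0] := pselect (exists x : X, True); last first.
  by exists 0 => x; case: X0; exists x.
have : compact (d x0 @` [set: X]).
  by apply: continuous_compact => //; apply/continuous_subspaceT/mdst_continuous.
move=> /compact_bounded[M [_ MP]]; exists ((M + 1) + (M + 1)) => x y.
have B z : d x0 z <= M + 1.
  apply: le_trans (ler_norm _) _; apply: (MP (M + 1)); first lra.
  by exists z.
apply: le_trans (mdst_triangle d x x0 y) _.
by rewrite (mdst_sym d x x0) lerD.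
Qed.

Lemma le_diam (R : realType) (X : topologicalType) (d : metric R X)
    (cX : compact [set: X]) (E : set X) x y :
  E x -> E y -> d x y <= diam d E.
Proof.
move=> Ex Ey; apply: ub_le_sup; last by exists x => //; exists y.
have [M MP] := mdst_bounded d cX.
by exists M => _ [u _ [v _ <-]].
Qed.

Lemma diam_le (R : realType) (X : topologicalType) (d : metric R X)
    (E : set X) x M :
  E x -> (forall y, E y -> d x y <= M) -> diam d E <= 2 * M.
Proof.
move=> Ex EM; apply: ge_sup; first by exists (d x x), x => //; exists x.
move=> _ [u Eu [v Ev <-]]; apply: le_trans (mdst_triangle d u x v) _.
by rewrite (mdst_sym d u x) mulr_natl mulr2n lerD ?EM.
Qed.

(** If all of [E] lay within a third of its diameter from [x], [diam_le] would make the diameter at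
    most two thirds of itself. *)
Lemma diam_far (R : realType) (X : topologicalType) (d : metric R X)
    (E : set X) x :
  E x -> 0 < diam d E -> exists2 y, E y & diam d E <= 3 * d x y.
Proof.
move=> Ex E0; apply: contrapT => nE.
have := @diam_le _ _ d E x (diam d E / 3) Ex.
suff H : forall y, E y -> d x y <= diam d E / 3 by move/(_ H); lra.
move=> y Ey; rewrite leNgt; apply/negP => H; apply: nE; exists y => //; lra.
Qed.

Lemma diam_gt0_neq (R : realType) (X : topologicalType) (d : metric R X)
    (E : set X) x :
  E x -> 0 < diam d E -> exists2 y, E y & x <> y.
Proof.
move=> Ex E0; have [y Ey dE] := diam_far Ex E0; exists y => // xy.
by move: dE; rewrite xy mdstxx; lra.
Qed.

Lemma diam_gt0 (R : realType) (X : topologicalType) (d : metric R X)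
    (cX : compact [set: X]) (E : set X) x y :
  E x -> E y -> x <> y -> 0 < diam d E.
Proof. by move=> Ex Ey /(mdst_gt0 d) /lt_le_trans; apply; exact: le_diam. Qed.

Lemma le_setdist (R : realType) (X : topologicalType) (d : metric R X)
    (E1 E2 : set X) x y M :
  E1 x -> E2 y -> (forall u v, E1 u -> E2 v -> M <= d u v) ->
  M <= setdist d E1 E2.
Proof.
move=> E1x E2y H; apply: lb_le_inf; first by exists (d x y), x => //; exists y.
by move=> _ [u E1u [v E2v <-]]; apply: H.
Qed.

Lemma setdist_le (R : realType) (X : topologicalType) (d : metric R X)
    (E1 E2 : set X) x y :
  E1 x -> E2 y -> setdist d E1 E2 <= d x y.
Proof.
move=> E1x E2y; apply: ge_inf; last by exists x => //; exists y.
by exists 0 => _ [u _ [v _ <-]]; exact: mdst_ge0.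
Qed.

(** * Ancestors of cells, cells at a point, positivity of diameters *)

Lemma sub_parent (X : topologicalType) (T : cell_structure X) n E :
  cells T n.+1 E -> E `<=` parent T n E.
Proof.
move=> cE x Ex; rewrite (cells_children (parent_cells cE)).
by exists E.
Qed.

Lemma sub_ancestor (X : topologicalType) (T : cell_structure X) m k E :
  cells T (m + k) E -> exists2 F, cells T m F & E `<=` F.
Proof.
elim: k E => [|k IH] E; first by rewrite addn0 => cE; exists E.
rewrite addnS => cE; have [F cF EF] := IH _ (parent_cells cE).
by exists F => //; apply: subset_trans EF; exact: sub_parent.
Qed.

Lemma cell_at (X : topologicalType) (T : cell_structure X) n x :
  exists2 E, cells T n E & E x.
Proof.
elim: n => [|n [E cE]]; first by exists setT => //; rewrite cells_root.
by rewrite {1}(cells_children cE) => -[E' [cE' _] E'x]; exists E'.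
Qed.

(** Comparing [E] with itself excludes diameter 0: since 0/0 = 0, the lower bound would read 1/C <=
    0. *)
Lemma decay_diam_gt0 (R : realType) (X : topologicalType)
    (T : cell_structure X) (d : metric R X) n E :
  compact [set: X] -> exponential_decay T d -> cells T n E -> 0 < diam d E.
Proof.
move=> cX [r1 [r2 [C [r10 _ _ C1 H]]]] cE.
have [x /interior_subset Ex] := cells_interior cE.
rewrite lt_neqAle; apply/andP; split; last first.
  by rewrite -(mdstxx d x); exact: le_diam.
apply/eqP => E0; have [|] := H n n E E (leqnn n) cE cE; first by exists x.
by rewrite -E0 invr0 mulr0 subnn expr0 div1r leNgt invr_gt0 (lt_le_trans ltr01).
Qed.

(** * Control functions and the transfer of diameters *)

(* Surjectivity onto [0, +oo[ rules out that eta is decreasing. *)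
Lemma half_line_homeomorphism (R : realType) (eta : R -> R) :
  homeomorphism [set t : R | 0 <= t] [set t : R | 0 <= t] eta ->
  [/\ forall s t, 0 <= s -> s <= t -> eta s <= eta t,
      forall t, 0 <= t -> 0 <= eta t &
      forall e, 0 < e -> exists2 t, 0 < t & eta t = e].
Proof.
move=> [eta0 [g [g0 gK Kg ceta _]]].
have inj : {in `[0, +oo[ &, injective eta}.
  move=> s t; rewrite !in_itv /= !andbT => s0 t0 st.
  by rewrite -(gK _ s0) -(gK _ t0) st.
have g00 : 0 <= g 0 by apply: g0 => /=.
have : {within [set` `[0, +oo[], continuous eta} by rewrite set_itvcy.
move=> /itv_continuous_inj_mono /(_ inj) [incr|decr]; last first.
  have e0 : 0 <= eta 0 by apply: eta0 => /=.
  have e1 : (0 : R) <= eta 0 + 1 by lra.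
  have : 0 <= g (eta 0 + 1) by apply: g0.
  rewrite le_eqVlt => /predU1P[E|].
    by have := Kg _ e1; rewrite -E => ?; lra.
  move=> /[dup] /ltW ge0 /decr; rewrite !in_itv /= lexx ge0 (Kg _ e1) => /(_ isT isT).
  lra.
have mono s t : 0 <= s -> s <= t -> eta s <= eta t.
  move=> s0; rewrite le_eqVlt => /predU1P[-> //|st].
  by apply/ltW/incr; rewrite ?in_itv //= ?s0 ?andbT // (le_trans s0 (ltW st)).
split => // e e0; exists (g e); last by apply: Kg; exact: ltW.
rewrite lt_neqAle g0 ?andbT /=; last exact: ltW.
apply/eqP => E; have := Kg e (ltW e0); rewrite -E => eta_e.
by have := mono 0 (g 0) (lexx _) g00; rewrite (Kg 0) //= eta_e leNgt e0.
Qed.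

Lemma qs_le (R : realType) (X : topologicalType) (d d' : metric R X)
    (eta : R -> R) t a b c :
  (forall s t, 0 <= s -> s <= t -> eta s <= eta t) ->
  (forall t, 0 <= t -> 0 <= eta t) ->
  (forall a b c : X, a <> b -> a <> c -> b <> c ->
      d' a b / d' a c <= eta (d a b / d a c)) ->
  0 <= t -> a <> c -> b <> c -> d a b <= t * d a c ->
  d' a b <= eta t * d' a c.
Proof.
move=> mono eta0 qs t0 ac bc dt.
have [->|/eqP ab] := eqVneq b a; first by rewrite mdstxx mulr_ge0 ?mdst_ge0 ?eta0.
rewrite -ler_pdivrMr ?mdst_gt0 //; apply: le_trans (qs _ _ _ _ ac bc) _.
  exact: nesym.
by apply: mono; rewrite ?divr_ge0 ?mdst_ge0 // ler_pdivrMr // mdst_gt0.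
Qed.

(** Take a common point [x], and [y] in [A] at least a third of the diameter away. Any [z] in [B]
    has d(x,z) <= 3s d(x,y), so d'(x,z) <= k d'(x,y). The factor 2 comes from measuring [B] from [x]
    only. *)
Lemma diam_transfer (R : realType) (X : topologicalType) (d d' : metric R X)
    (cX : compact [set: X]) (A B : set X) (s k : R) :
  A `&` B !=set0 -> 0 < diam d A -> diam d B <= s * diam d A ->
  0 <= s -> 0 <= k ->
  (forall a b c, a <> c -> d a b <= 3 * s * d a c -> d' a b <= k * d' a c) ->
  diam d' B <= 2 * k * diam d' A.
Proof.
move=> [x [Ax Bx]] A0 BA s0 k0 H.
have [y Ay dy] := diam_far Ax A0.
rewrite -mulrA; apply: (diam_le Bx) => z Bz.
apply: (@le_trans _ _ (k * d' x y)); last by rewrite ler_wpM2l // le_diam.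
apply: H; first by move=> xy; move: dy; rewrite xy mdstxx; lra.
apply: le_trans (le_diam d cX Bx Bz) _; apply: le_trans BA _.
by rewrite [3 * s]mulrC -mulrA ler_wpM2l.
Qed.

(** * Exponential decay from bounded steps; quasisymmetric invariance *)

Lemma exprn_eventually_le (R : realType) (a b : R) :
  0 <= a -> a < 1 -> 0 < b ->
  exists N, forall n, (N <= n)%N -> a ^+ n <= b.
Proof.
move=> a0 a1 b0; have : `|a| < 1 by rewrite ger0_norm.
move=> /cvg_expr /cvgrPdist_le /(_ b b0) [N _ NP]; exists N => n Nn.
by have := NP n Nn; rewrite /= sub0r normrN ger0_norm // exprn_ge0.
Qed.

Lemma bernoulli_le (R : realFieldType) (x : R) n :
  0 <= x -> x <= 1 -> 1 - n%:R * x <= (1 - x) ^+ n.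
Proof.
move=> x0 x1; elim: n => [|n IH]; first by rewrite mul0r subr0 expr0.
rewrite exprSr; apply: le_trans (_ : (1 - n%:R * x) * (1 - x) <= _); last first.
  by rewrite ler_wpM2r // subr_ge0.
have : 0 <= n%:R * (x * x) by rewrite !mulr_ge0.
by rewrite mulrS; lra.
Qed.

(** Steps can be chained because every ancestor of [E'] still contains the point that [E'] shares
    with [E]. *)
Lemma exponential_decay_of_steps (R : realType) (X : topologicalType)
    (T : cell_structure X) (d : metric R X) (K : R) (N : nat) :
  2 <= K -> (0 < N)%N ->
  (forall n E, cells T n E -> 0 < diam d E) ->
  (forall m n E E', (m <= n)%N -> cells T m E -> cells T n E' ->
     E `&` E' !=set0 -> diam d E' <= K * diam d E) ->
  (forall m n E E', (m + N <= n)%N -> cells T m E -> cells T n E' ->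
     E `&` E' !=set0 -> diam d E' <= 2^-1 * diam d E) ->
  (forall m n E E', (m <= n <= m.+1)%N -> cells T m E -> cells T n E' ->
     E `&` E' !=set0 -> diam d E <= K * diam d E') ->
  exponential_decay T d.
Proof.
move=> K2 N0 dgt0 up half low.
have K0 : 0 < K by lra.
(* Each block of [N] levels halves; the leftover levels cost one factor [K]. *)
have upq q m n E E' : (m + q * N <= n)%N -> cells T m E -> cells T n E' ->
     E `&` E' !=set0 -> diam d E' <= K * 2^-1 ^+ q * diam d E.
  elim: q m E => [|q IH] m E mn cE cE' EE'.
    by rewrite expr0 mulr1; apply: (up m n) => //; lia.
  have {}mn : (m + N + q * N <= n)%N by move: mn; rewrite mulSn addnA.
  have [k nk] : exists k, n = (m + N + k)%N.
    by exists (n - (m + N))%N; rewrite subnKC // (leq_trans _ mn) // leq_addr.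
  have [F cF E'F] : exists2 F, cells T (m + N) F & E' `<=` F.
    by apply: (@sub_ancestor _ _ _ k); rewrite -nk.
  have [x [Ex E'x]] := EE'.
  apply: le_trans (IH _ F mn cF cE' _) _; first by exists x; split => //; exact: E'F.
  rewrite exprSr mulrA -!mulrA !ler_pM2l ?exprn_gt0 ?invr_gt0 //.
  by apply: half cE cF _ => //; exists x; split => //; exact: E'F.
(* The exponent is [k.+1] because comparing two cells of the same level already costs [K]. *)
have lowk k m E E' : cells T m E -> cells T (m + k) E' ->
     E `&` E' !=set0 -> diam d E <= K ^+ k.+1 * diam d E'.
  elim: k E' => [|k IH] E' cE cE' EE'.
    by rewrite expr1; apply: low cE cE' EE'; lia.
  rewrite addnS in cE'; have sub := sub_parent cE'.
  have [x [Ex E'x]] := EE'.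
  apply: le_trans (IH _ cE (parent_cells cE') _) _.
    by exists x; split => //; exact: sub.
  rewrite (exprSr _ k.+1) -mulrA ler_pM2l ?exprn_gt0 //.
  apply: low (parent_cells cE') cE' _; first by lia.
  by exists x; split => //; exact: sub.
(* The rate [1 - x] replaces the root 2^(-1/N): by Bernoulli its [N]-th power is at least 1 - N x =
   1/2. *)
pose x : R := (2 * N%:R)^-1.
have N1 : 1 <= N%:R :> R by rewrite ler1n.
have x0 : 0 < x by rewrite invr_gt0; lra.
have x2 : x <= 2^-1 by rewrite lef_pV2 ?posrE; lra.
have xN : 2^-1 <= (1 - x) ^+ N.
  apply: le_trans (@bernoulli_le _ x N _ _); try lra.
  by rewrite /x; have : N%:R * (2 * N%:R)^-1 = 2^-1 :> R; [field|]; lra.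
exists K^-1, (1 - x), (2 * K); split; try lra.
- by rewrite invr_gt0.
- by apply: (@le_trans _ _ 2^-1); [rewrite lef_pV2 ?posrE|]; lra.
move=> m n E E' mn cE cE' EE'; split.
  have [k nk] : exists k, n = (m + k)%N by exists (n - m)%N; rewrite subnKC.
  subst n; rewrite addKn ler_pdivlMr ?(dgt0 _ _ cE) //.
  rewrite mulrAC ler_pdivrMr ?mulr_gt0 //.
  rewrite exprVn ler_pdivrMl ?exprn_gt0 //.
  apply: le_trans (lowk _ _ _ _ cE cE' EE') _.
  rewrite exprSr -mulrA ler_pM2l ?exprn_gt0 // mulrC.
  have := mulr_gt0 (dgt0 _ _ cE') K0; lra.
rewrite ler_pdivrMr ?(dgt0 _ _ cE) //.
(* The remainder [s] accounts for the 2 in [2 * K], as (1 - x)^s >= 1/2. *)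
have := divn_eq (n - m) N; set q := (_ %/ _)%N; set s := (_ %% _)%N => nms.
have sN : (s <= N)%N by apply: ltnW; rewrite ltn_mod.
have /upq /(_ cE cE' EE') : (m + q * N <= n)%N by lia.
move=> /le_trans; apply; rewrite ler_pM2r ?(dgt0 _ _ cE) //.
rewrite [2 * K]mulrC -mulrA ler_pM2l // nms exprD mulrCA mulnC exprM.
have hs : 2^-1 <= (1 - x) ^+ s.
  apply: le_trans xN _; apply: ler_wiXn2l; rewrite ?sN //; lra.
apply: (@le_trans _ _ (((1 - x) ^+ N) ^+ q)); first by rewrite lerXn2r ?nnegrE //; lra.
rewrite ler_peMr ?exprn_ge0; lra.
Qed.

Lemma undistorted_quasisymmetric (R : realType) (X : topologicalType)
    (cX : compact [set: X]) (T : cell_structure X) (d d' : metric R X) :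
  undistorted T d -> quasisymmetrically_equivalent d d' -> undistorted T d'.
Proof.
move=> [dec [delta delta0 sep]] [_ [eta /half_line_homeomorphism [mono eta0 small] qs]].
have dgt0 := decay_diam_gt0 cX dec.
have dgt0' n E : cells T n E -> 0 < diam d' E.
  move=> cE; have [x /interior_subset Ex] := cells_interior cE.
  have [y Ey xy] := diam_gt0_neq Ex (dgt0 _ _ cE).
  exact: diam_gt0 xy.
(* The summand 1 covers [b = c], where the quasisymmetry inequality says nothing. *)
pose H t := 1 + eta t.
have qsH t a b c : 0 <= t -> a <> c -> d a b <= t * d a c ->
    d' a b <= H t * d' a c.
  move=> t0 ac dt; have := eta0 t t0; have := mdst_ge0 d' a c => ? ?.
  have [->|/eqP bc] := eqVneq b c; rewrite /H mulrDl mul1r.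
    by rewrite lerDl mulr_ge0.
  by apply: ler_wpDl => //; apply: (qs_le mono eta0 qs).
have H1 t : 0 <= t -> 1 <= H t by move=> /eta0 ?; rewrite /H; lra.
split; last first.
  (* For [u], [w] in [E1] and [v] in [E2], separation gives d(u,w) <= d(u,v)/delta, hence d'(u,w) <=
     H(1/delta) d'(u,v); [diam_le] adds the 2. *)
  exists (2 * H delta^-1)^-1.
    have := H1 delta^-1; rewrite invr_ge0 invr_gt0 (ltW delta0) => /(_ isT); lra.
  move=> n E1 E2 c1 c2 E12.
  have [x /interior_subset E1x] := cells_interior c1.
  have [y /interior_subset E2y] := cells_interior c2.
  apply: (le_setdist E1x E2y) => u v E1u E2v.
  have h1 : 1 <= H delta^-1 by rewrite H1 // invr_ge0 ltW.
  rewrite mulrC ler_pdivrMr; last by lra.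
  rewrite mulrC -mulrA; apply: (diam_le E1u) => w E1w.
  apply: qsH; first by rewrite invr_ge0 ltW.
    move=> uv; have : (E1 `&` E2) u by split => //; rewrite uv.
    by rewrite E12.
  rewrite ler_pdivlMl //; apply: (@le_trans _ _ (delta * diam d E1)).
    by rewrite ler_pM2l // le_diam.
  exact: le_trans (sep _ _ _ c1 c2 E12) (setdist_le d E1u E2v).
have [r1 [r2 [C [r10 r12 r21 C1 dH]]]] := dec.
have r2p : 0 < r2 by lra.
have C0 : 0 < C by lra.
have r1C : 0 < C / r1 by rewrite divr_gt0.
(* [diam_transfer] doubles the 1/4 into the required 1/2. *)
have [t t0 et] : exists2 t, 0 < t & eta t = 4^-1 by apply: small; lra.
(* A ratio at most 1/2 also excludes [b = c], so [eta] itself applies; [H], being at least 1, could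
   not give halving. *)
pose t1 := Num.min t 2^-1.
have t10 : 0 < t1 by rewrite lt_min t0; lra.
have et1 : eta t1 <= 4^-1 by rewrite -et mono ?(ltW t10) // ge_min lexx.
have t1h : t1 <= 2^-1 by rewrite ge_min lexx orbT.
have [N N0 r2N] : exists2 N, (0 < N)%N & 3 * C * r2 ^+ N <= t1.
  have e0 : 0 < t1 / (3 * C) by rewrite divr_gt0 //; lra.
  have [N NP] := exprn_eventually_le (ltW r2p) r21 e0; exists N.+1 => //.
  by have := NP N.+1 (leqnSn N); rewrite ler_pdivlMr 1?mulrC //; lra.
(* One term per use of [diam_transfer]: diam E' <= C diam E at any deeper level, and diam E <=
   (C/r1) diam E' at most one level down. *)
pose K := 2 * (H (3 * C) + H (3 * (C / r1))).
have HC := H1 (3 * C); have HCr := H1 (3 * (C / r1)).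
have {}HC : 1 <= H (3 * C) by apply: HC; lra.
have {}HCr : 1 <= H (3 * (C / r1)) by apply: HCr; lra.
have upd m n E E' : (m <= n)%N -> cells T m E -> cells T n E' ->
    E `&` E' !=set0 -> diam d E' <= C * r2 ^+ (n - m) * diam d E.
  move=> mn cE cE' EE'; have [_] := dH _ _ _ _ mn cE cE' EE'.
  by rewrite ler_pdivrMr // (dgt0 _ _ cE).
have r2X k : 0 < r2 ^+ k by rewrite exprn_gt0.
apply: (@exponential_decay_of_steps _ _ _ _ K N) => //.
- by rewrite /K; lra.
- move=> m n E E' mn cE cE' EE'.
  apply: (@le_trans _ _ (2 * H (3 * C) * diam d' E)); last first.
    by rewrite ler_pM2r ?(dgt0' _ _ cE) // /K; lra.
  apply: (diam_transfer cX EE' (dgt0 _ _ cE) _ (ltW C0)); [|lra|].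
    apply: le_trans (upd _ _ _ _ mn cE cE' EE') _.
    rewrite ler_pM2r ?(dgt0 _ _ cE) // ger_pMr //.
    by rewrite exprn_ile1 //; lra.
  by move=> a b c; apply: qsH; lra.
- move=> m n E E' mn cE cE' EE'.
  have -> : 2^-1 = 2 * 4^-1 :> R by field.
  pose s := t1 / 3; have s3 : 3 * s = t1 by rewrite /s; field.
  apply: (@diam_transfer _ _ d d' cX E E' s) => //; rewrite ?(dgt0 _ _ cE) //; try lra.
    have mn' : (m <= n)%N by exact: leq_trans (leq_addr _ _) mn.
    apply: le_trans (upd _ _ _ _ mn' cE cE' EE') _.
    rewrite ler_pM2r ?(dgt0 _ _ cE) // /s ler_pdivlMr; last lra.
    apply: le_trans r2N; rewrite mulrC mulrA ler_pM2l; last lra.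
    by apply: ler_wiXn2l; [lra|lra|rewrite leq_subRL].
  rewrite s3 => a b c ac dab; have ? := mdst_gt0 d ac; have ? := mdst_gt0 d' ac.
  apply: (@le_trans _ _ (eta t1 * d' a c)); last by rewrite ler_pM2r.
  apply: (qs_le mono eta0 qs) => //; first lra.
  move=> bc; move: dab; rewrite bc; have := mulr_ge0 (ltW t10) (ltW (mdst_gt0 d ac)).
  have : t1 * d a c <= 2^-1 * d a c by rewrite ler_pM2r.
  lra.
move=> m n E E' mn cE cE' EE'.
apply: (@le_trans _ _ (2 * H (3 * (C / r1)) * diam d' E')); last first.
  by rewrite ler_pM2r ?(dgt0' _ _ cE') // /K; lra.
apply: (diam_transfer cX _ (dgt0 _ _ cE') _ (ltW r1C)); [by rewrite setIC| |lra|].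
  have [mn' nm] := andP mn.
  have [+ _] := dH _ _ _ _ mn' cE cE' EE'.
  rewrite ler_pdivlMr ?(dgt0 _ _ cE) // mulrAC ler_pdivrMr // => le1.
  rewrite mulrAC ler_pdivlMr // mulrC [C * _]mulrC; apply: le_trans le1.
  (* [n - m] is 0 or 1, hence r1 <= r1^(n-m). *)
  rewrite ler_pM2r ?(dgt0 _ _ cE) // -[leLHS]expr1.
  by apply: ler_wiXn2l; [lra|lra|rewrite leq_subLR addn1].
by move=> a b c; apply: qsH; lra.
Qed.

(** * Homeomorphisms of the half-line built from square roots and squares *)

(* sqrt_sqr is t |-> t^(1/2) on [0, 1] and t |-> t^2 on [1, +oo[, so its j-th
   iterate is t |-> max (t^(1/2^j)) (t^(2^j)). *)
Definition sqrt_sqr {R : realType} (t : R) : R := Num.max (Num.sqrt t) (t ^+ 2).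

Definition sqrt_sqr_inv {R : realType} (t : R) : R :=
  Num.min (Num.sqrt t) (t ^+ 2).

Lemma sqrt_sqr_ge0 (R : realType) (t : R) : 0 <= sqrt_sqr t.
Proof. by rewrite le_max sqrtr_ge0. Qed.

Lemma sqrt_sqr_inv_ge0 (R : realType) (t : R) : 0 <= sqrt_sqr_inv t.
Proof. by rewrite le_min sqrtr_ge0 sqr_ge0. Qed.

(** On [0, 1], t^2 <= t <= sqrt t; beyond 1 the order reverses. Both maps preserve the two
    intervals, so this case form shows them mutually inverse. *)
Lemma sqrt_sqrE (R : realType) (t : R) : 0 <= t ->
  (sqrt_sqr t = if t <= 1 then Num.sqrt t else t ^+ 2) *
  (sqrt_sqr_inv t = if t <= 1 then t ^+ 2 else Num.sqrt t).
Proof.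
move=> t0; rewrite /sqrt_sqr /sqrt_sqr_inv.
have s0 := sqrtr_ge0 t; have st := sqr_sqrtr t0.
case: (leP t 1) => t1.
  have s1 : Num.sqrt t <= 1 by rewrite -sqrtr1 ler_wsqrtr.
  have le : t ^+ 2 <= Num.sqrt t.
    apply: (@le_trans _ _ t); first by rewrite expr2 ler_piMl.
    by rewrite -{1}st expr2 ler_piMl.
  by split; [apply/max_idPl|apply/min_idPr].
have s1 : 1 <= Num.sqrt t by rewrite -sqrtr1 ler_wsqrtr // ltW.
have le : Num.sqrt t <= t ^+ 2.
  apply: (@le_trans _ _ t); last by rewrite expr2 ler_peMl // ltW.
  by rewrite -{2}st expr2 ler_peMl.
by split; [exact/max_idPr|exact/min_idPl].
Qed.

Lemma sqrt_sqrK (R : realType) (t : R) : 0 <= t ->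
  sqrt_sqr_inv (sqrt_sqr t) = t.
Proof.
move=> t0; rewrite (sqrt_sqrE (sqrt_sqr_ge0 t)) !(sqrt_sqrE t0).
case: (leP t 1) => t1.
  have -> : Num.sqrt t <= 1 by rewrite -sqrtr1 ler_wsqrtr.
  exact: sqr_sqrtr.
by rewrite leNgt exprn_egt1 //= sqrtr_sqr ger0_norm.
Qed.

Lemma sqrt_sqr_invK (R : realType) (t : R) : 0 <= t ->
  sqrt_sqr (sqrt_sqr_inv t) = t.
Proof.
move=> t0; rewrite (sqrt_sqrE (sqrt_sqr_inv_ge0 t)) !(sqrt_sqrE t0).
case: (leP t 1) => t1; first by rewrite exprn_ile1 // sqrtr_sqr ger0_norm.
have s1 : 1 < Num.sqrt t by rewrite -[ltLHS]sqrtr1 ltr_sqrt // (lt_trans ltr01).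
by rewrite leNgt s1 /= sqr_sqrtr.
Qed.

Lemma le_sqrt_sqr (R : realType) (s t : R) : 0 <= s -> s <= t ->
  sqrt_sqr s <= sqrt_sqr t.
Proof.
move=> s0 st; rewrite ge_max !le_max ler_wsqrtr //=.
by rewrite lerXn2r ?orbT // nnegrE // (le_trans s0).
Qed.

Lemma sqrt_sqr_continuous (R : realType) :
  continuous (@sqrt_sqr R) /\ continuous (@sqrt_sqr_inv R).
Proof.
split=> t.
  apply: (@continuous_max R R Num.sqrt (fun t => t ^+ 2)).
    exact: sqrt_continuous.
  exact: exprn_continuous.
apply: (@continuous_min R R Num.sqrt (fun t => t ^+ 2)).
  exact: sqrt_continuous.
exact: exprn_continuous.
Qed.

Section Iterate.
Context {R : realType}.
Implicit Types (f : R -> R) (s t : R) (j : nat).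

Lemma iter_continuous f j : continuous f -> continuous (iter j f).
Proof.
move=> cf; elim: j => [|j IH] t; first exact: cvg_id.
exact: (continuous_comp (IH t) (cf _)).
Qed.

Lemma iter_ge0 f j t : (forall t, 0 <= f t) -> 0 <= t -> 0 <= iter j f t.
Proof. by move=> f0 t0; case: j => //= j. Qed.

Lemma iter_can_ge0 f (g : R -> R) j t :
  (forall t, 0 <= f t) -> (forall t, 0 <= t -> g (f t) = t) ->
  0 <= t -> iter j g (iter j f t) = t.
Proof.
move=> f0 gK t0; elim: j => // j IH.
by rewrite iterSr /= gK // iter_ge0.
Qed.

Lemma le_iter_sqrt_sqr j s t : 0 <= s -> s <= t ->
  iter j sqrt_sqr s <= iter j sqrt_sqr t.
Proof.
move=> s0 st; elim: j => //= j IH.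
by apply: le_sqrt_sqr => //; apply: iter_ge0 => // u; exact: sqrt_sqr_ge0.
Qed.

(** Serves when [b] separates from [a] at an earlier level than [c]. *)
Lemma expr_le_iter_sqrt_sqr j t : 0 <= t -> t ^+ (2 ^ j) <= iter j sqrt_sqr t.
Proof.
move=> t0; elim: j => [|j IH]; first by rewrite expr1.
rewrite /= expnSr exprM; apply: le_trans (_ : (iter j sqrt_sqr t) ^+ 2 <= _).
  rewrite lerXn2r ?nnegrE ?exprn_ge0 //; apply: iter_ge0 => // u.
  exact: sqrt_sqr_ge0.
by rewrite /sqrt_sqr le_max lexx orbT.
Qed.

(** The square root in each iterate undoes one squaring. Serves when [b] separates from [a] no
    earlier than [c]. *)
Lemma le_iter_sqrt_sqr_expr j t : 0 <= t -> t <= iter j sqrt_sqr (t ^+ (2 ^ j)).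
Proof.
move=> t0; elim: j => [|j IH]; first by rewrite expr1.
apply: le_trans IH _; rewrite iterSr; apply: le_iter_sqrt_sqr.
  exact: exprn_ge0.
rewrite expnSr exprM /sqrt_sqr le_max sqrtr_sqr ger0_norm ?lexx //.
exact: exprn_ge0.
Qed.

Lemma scaled_iter_sqrt_sqr_homeomorphism (K L : R) j : 0 < K -> 0 < L ->
  homeomorphism [set t : R | 0 <= t] [set t : R | 0 <= t]
    (fun t => L * iter j sqrt_sqr (K * t)).
Proof.
move=> K0 L0; have [cs ci] := sqrt_sqr_continuous R.
have cont f a b : continuous f -> continuous (fun t => b * iter j f (a * t)).
  move=> cf t; apply: (@continuous_comp _ _ _ (fun t => iter j f (a * t)) ( *%R b)).
    apply: (@continuous_comp _ _ _ ( *%R a) (iter j f)).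
      exact: mulrl_continuous.
    exact: iter_continuous.
  exact: mulrl_continuous.
split=> [t t0 /=|].
  apply: mulr_ge0; first exact: ltW.
  by apply: iter_ge0; [exact: sqrt_sqr_ge0|exact: mulr_ge0 (ltW K0) t0].
exists (fun t => K^-1 * iter j sqrt_sqr_inv (L^-1 * t)); split.
- move=> t t0 /=; rewrite mulr_ge0 ?invr_ge0 ?(ltW K0) // iter_ge0 //.
    exact: sqrt_sqr_inv_ge0.
  by rewrite mulr_ge0 // invr_ge0 ltW.
- move=> t t0; rewrite mulKf ?gt_eqF // iter_can_ge0 ?mulKf ?gt_eqF //.
  + exact: sqrt_sqr_ge0.
  + exact: sqrt_sqrK.
  + by rewrite mulr_ge0 // ltW.
- move=> t t0; rewrite mulVKf ?gt_eqF // iter_can_ge0 ?mulVKf ?gt_eqF //.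
  + exact: sqrt_sqr_inv_ge0.
  + exact: sqrt_sqr_invK.
  + by rewrite mulr_ge0 // invr_ge0 ltW.
- exact/continuous_subspaceT/cont.
- exact/continuous_subspaceT/cont.
Qed.

End Iterate.

(** * Separation levels and the comparison of undistorted metrics *)

(** A point may lie in several n-cells. One meeting pair suffices here, so the negation makes all
    pairs around [a] and [b] disjoint. *)
Definition cells_meet_at (X : topologicalType) (T : cell_structure X) (n : nat)
    (a b : X) : Prop :=
  exists E E', [/\ cells T n E, cells T n E', E a, E' b & E `&` E' !=set0].

(* This level depends only on the cell structure, which is what makes two
   undistorted metrics comparable. *)
Definition separation_level (X : topologicalType) (T : cell_structure X)
    (n : nat) (a b : X) : Prop :=
  cells_meet_at T n a b /\ ~ cells_meet_at T n.+1 a b.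

Lemma exponential_decay_le (R : realType) (X : topologicalType)
    (cX : compact [set: X]) (T : cell_structure X) (d : metric R X) :
  exponential_decay T d ->
  exists r1 r2 C : R, [/\ 0 < r1, 0 < r2, r2 < 1, 1 <= C &
    forall m n E E', (m <= n)%N -> cells T m E -> cells T n E' ->
      E `&` E' !=set0 ->
      r1 ^+ (n - m) * diam d E <= C * diam d E' /\
      diam d E' <= C * r2 ^+ (n - m) * diam d E].
Proof.
move=> dec; have [r1 [r2 [C [r10 r12 r21 C1 H]]]] := dec.
exists r1, r2, C; split => //; first lra.
move=> m n E E' mn cE cE' EE'.
have E0 := decay_diam_gt0 cX dec cE; have C0 : 0 < C by lra.
have [+ +] := H m n E E' mn cE cE' EE'.
by rewrite ler_pdivlMr // ler_pdivrMr // mulrAC ler_pdivrMr // [C * diam _ _]mulrC.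
Qed.

(** The root contains both points. Without a separation level, cells around them would meet at every
    level, and d(a,b) is at most the sum of their diameters, which tends to 0. *)
Lemma separation_level_exists (R : realType) (X : topologicalType)
    (cX : compact [set: X]) (T : cell_structure X) (d : metric R X) a b :
  undistorted T d -> a <> b -> exists n, separation_level T n a b.
Proof.
move=> [dec _] ab; apply: contrapT => no.
have root : cells T 0 setT by rewrite cells_root.
have meet n : cells_meet_at T n a b.
  elim: n => [|n IH]; first by exists setT, setT; split => //; exists a.
  by apply: contrapT => nm; apply: no; exists n.
have X0 := decay_diam_gt0 cX dec root.
have [r1 [r2 [C [_ r20 r21 C1 H]]]] := exponential_decay_le cX dec.
have ab0 := mdst_gt0 d ab.
have C0 : 0 < C by lra.
(* The 4 makes each of the two cells have diameter at most d(a,b)/4. *)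
have e0 : 0 < d a b / (4 * C * diam d setT) by rewrite divr_gt0 ?mulr_gt0.
have [N /(_ N (leqnn N))] := exprn_eventually_le (ltW r20) r21 e0.
rewrite ler_pdivlMr ?mulr_gt0 // => small.
have [E [E' [cE cE' Ea E'b [z [Ez E'z]]]]] := meet N.
have := mdst_triangle d a z b.
have := le_diam d cX Ea Ez; have := le_diam d cX E'z E'b.
have [|_] := H 0%N N setT E (leq0n N) root cE; first by exists a.
have [|_] := H 0%N N setT E' (leq0n N) root cE'; first by exists b.
rewrite subn0; lra.
Qed.

Lemma separation_level_diam (R : realType) (X : topologicalType)
    (cX : compact [set: X]) (T : cell_structure X) (d : metric R X) :
  undistorted T d ->
  exists2 K, 0 < K & forall n a b E, separation_level T n a b ->
    cells T n E -> E a -> d a b <= K * diam d E /\ diam d E <= K * d a b.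
Proof.
move=> [dec [delta delta0 sep]].
have [r1 [r2 [C [r10 r20 r21 C1 H]]]] := exponential_decay_le cX dec.
have C0 : 0 < C by lra.
have CC0 : 0 < C * C by exact: mulr_gt0.
have D0 : 0 < C / (r1 * delta) by rewrite divr_gt0 // mulr_gt0.
(* [C] and [C * C] bound the diameters of [F] and [F'] against that of [E], the latter through [F];
   the third term is for the lower bound on d(a,b). *)
exists (C + C * C + C / (r1 * delta)); first by rewrite !addr_gt0.
move=> n a b E [[F [F' [cF cF' Fa F'b FF']]] nmeet] cE Ea.
have E0 := decay_diam_gt0 cX dec cE.
split.
  have [z [Fz F'z]] := FF'.
  have := mdst_triangle d a z b.
  have := le_diam d cX Fa Fz; have := le_diam d cX F'z F'b.
  have [|_] := H n n E F (leqnn n) cE cF; first by exists a.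
  have [_] := H n n F F' (leqnn n) cF cF' FF'.
  rewrite subnn expr0 mulr1 => h1 h2 h3 h4 h5.
  have h6 : C * diam d F <= C * C * diam d E by rewrite -mulrA ler_pM2l.
  rewrite !mulrDl; have := mulr_gt0 D0 E0; lra.
(* Any (n+1)-cells around [a] and [b] are disjoint, so d(a,b) >= delta diam G; [E] and [G] share
   [a], so diam G >= (r1/C) diam E. *)
have [G cG Ga] := cell_at T n.+1 a.
have [G' cG' G'b] := cell_at T n.+1 b.
have GG' : G `&` G' = set0.
  apply: contrapT => /eqP/set0P GG'; apply: nmeet.
  by exists G, G'; split.
have h1 := le_trans (sep _ _ _ cG cG' GG') (setdist_le d Ga G'b).
have [|+ _] := H n n.+1 E G (leqnSn n) cE cG; first by exists a.
rewrite subSnn expr1 => h2.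
have h3 : diam d E <= C / (r1 * delta) * d a b.
  rewrite mulrAC ler_pdivlMr ?mulr_gt0 //.
  have h4 : C * (delta * diam d G) <= C * d a b by rewrite ler_pM2l.
  have h5 : delta * (r1 * diam d E) <= delta * (C * diam d G) by rewrite ler_pM2l.
  lra.
have := mdst_ge0 d a b; rewrite !mulrDl => ab0.
by have := mulr_ge0 (ltW C0) ab0; have := mulr_ge0 (ltW CC0) ab0; lra.
Qed.

(** Cells of levels [q] and [p] at [a] share [a], so decay compares their diameters; passing to
    distances costs a factor at either end. *)
Lemma separation_level_ratio (R : realType) (X : topologicalType)
    (cX : compact [set: X]) (T : cell_structure X) (d : metric R X) :
  undistorted T d ->
  exists r1 r2 K : R, [/\ 0 < r1, 0 < r2, r2 < 1, 0 < K &
    forall p q a b c, (q <= p)%N -> separation_level T p a b ->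
      separation_level T q a c ->
      r1 ^+ (p - q) * d a c <= K * d a b /\
      d a b <= K * r2 ^+ (p - q) * d a c].
Proof.
move=> ud; have [L L0 LP] := separation_level_diam cX ud.
have [dec _] := ud.
have [r1 [r2 [C [r10 r20 r21 C1 H]]]] := exponential_decay_le cX dec.
have C0 : 0 < C by lra.
exists r1, r2, (L * C * L); split => //; first by rewrite !mulr_gt0.
move=> p q a b c qp sb sc.
have [E cE Ea] := cell_at T q a; have [F cF Fa] := cell_at T p a.
have [h1 h2] := LP _ _ _ _ sc cE Ea; have [h3 h4] := LP _ _ _ _ sb cF Fa.
have [|h5 h6] := H q p E F qp cE cF; first by exists a.
have r1k : 0 < r1 ^+ (p - q) by rewrite exprn_gt0.
have r2k : 0 < r2 ^+ (p - q) by rewrite exprn_gt0.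
split.
  apply: (@le_trans _ _ (L * (r1 ^+ (p - q) * diam d E))).
    by rewrite mulrCA ler_pM2l.
  rewrite -!mulrA ler_pM2l //; apply: le_trans h5 _; by rewrite ler_pM2l.
apply: le_trans h3 _; rewrite -!mulrA ler_pM2l //; apply: le_trans h6 _.
by rewrite -mulrA ler_pM2l // mulrCA ler_pM2l.
Qed.

Lemma undistorted_equivalent (R : realType) (X : topologicalType)
    (cX : compact [set: X]) (T : cell_structure X) (d d' : metric R X) :
  undistorted T d -> undistorted T d' -> quasisymmetrically_equivalent d d'.
Proof.
move=> ud ud'; split.
  by split=> //; exists id; split => //; apply: continuous_subspaceT => x; exact: cvg_id.
have [r1 [r2 [K [r10 r20 r21 K0 H]]]] := separation_level_ratio cX ud.
have [r1' [r2' [K' [r10' r20' r21' K0' H']]]] := separation_level_ratio cX ud'.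
have [N1 HN1] := exprn_eventually_le (ltW r20) r21 r10'.
have [N2 HN2] := exprn_eventually_le (ltW r20') r21' r10.
(* Iterates of [sqrt_sqr] give exponents 2^j only; this one brings the upper rate of each metric
   below the lower rate of the other. *)
pose j := maxn N1 N2; have j2 : (j <= 2 ^ j)%N by exact/ltnW/ltn_expl.
have {}HN1 : r2 ^+ (2 ^ j) <= r1' by apply/HN1/(leq_trans _ j2)/leq_maxl.
have {}HN2 : r2' ^+ (2 ^ j) <= r1 by apply/HN2/(leq_trans _ j2)/leq_maxr.
exists (fun t => K' * iter j sqrt_sqr (K * t)).
  exact: scaled_iter_sqrt_sqr_homeomorphism.
move=> a b c ab ac _.
have [p pb] := separation_level_exists cX ud ab.
have [q qc] := separation_level_exists cX ud ac.
have dab := mdst_gt0 d ab; have dac := mdst_gt0 d ac.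
have dab' := mdst_gt0 d' ab; have dac' := mdst_gt0 d' ac.
(* If [q <= p], put u = r2'^(p-q): the d'-ratio is at most K' u, and u^(2^j) <= r1^(p-q) <= K
   d(a,b)/d(a,c). *)
have [qp|pq] := leqP q p.
  have [h _] := H _ _ _ _ _ qp pb qc; have [_ h'] := H' _ _ _ _ _ qp pb qc.
  rewrite ler_pdivrMr //; apply: le_trans h' _; rewrite ler_pM2r // ler_pM2l //.
  apply: le_trans (@le_iter_sqrt_sqr_expr _ j _ _) _; first exact/exprn_ge0/ltW.
  apply: le_iter_sqrt_sqr; first exact/exprn_ge0/exprn_ge0/ltW.
  rewrite mulrA ler_pdivlMr //; apply: le_trans h; rewrite ler_pM2r //.
  by rewrite exprAC lerXn2r // nnegrE ?exprn_ge0 // ltW.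
(* Now [b] and [c] exchange roles. With v = r2^-(q-p), v <= K d(a,b)/d(a,c), and the d'-ratio is at
   most K' r1'^-(q-p) <= K' v^(2^j). *)
have [_ h] := H _ _ _ _ _ (ltnW pq) qc pb.
have [h' _] := H' _ _ _ _ _ (ltnW pq) qc pb.
have r2k k : 0 < r2 ^+ k by rewrite exprn_gt0.
have r1k' k : 0 < r1' ^+ k by rewrite exprn_gt0.
apply: (@le_trans _ _ (K' * (r2 ^- (q - p)) ^+ (2 ^ j))).
  rewrite ler_pdivrMr //.
  apply: (@le_trans _ _ (K' * (r1' ^- (q - p)) * d' a c)).
    by rewrite mulrAC ler_pdivlMr // mulrC.
  rewrite ler_pM2r // ler_pM2l // exprVn lef_pV2 ?posrE ?exprn_gt0 //.
  by rewrite exprAC lerXn2r // nnegrE ?exprn_ge0 // ltW.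
rewrite ler_pM2l //; apply: le_trans (expr_le_iter_sqrt_sqr j _) _.
  by rewrite invr_ge0 ltW.
apply: le_iter_sqrt_sqr; first by rewrite invr_ge0 ltW.
by rewrite mulrA ler_pdivlMr // ler_pdivrMl // mulrCA mulrA.
Qed.

Theorem theorem9 (R : realType) (X : topologicalType)
    (X_metrizable : metrizable R X)
    (X_compact : compact [set: X]) (X_connected : connected [set: X])
    (T : cell_structure X) :
  (forall d d' : metric R X, undistorted T d -> undistorted T d' ->
     quasisymmetrically_equivalent d d') /\
  (forall d d' : metric R X, undistorted T d ->
     quasisymmetrically_equivalent d d' -> undistorted T d').
Proof.
by split=> d d'; [exact: undistorted_equivalent|exact: undistorted_quasisymmetric].
Qed.
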